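(* For all friezes $D_1$ and $D_2$, $\varphi(D_2\circ D_1)=\varphi(D_2)\circ\varphi(D_1)$, where for a frieze $D$ the function $\varphi(D):\mathbb{N}\to\mathbb{N}$ is the order-preserving function mapping $n$ to the number assigned to $n$ by the transversal pair of $D$ covering $n$.
   Context: $\mathbb{N}$ includes $0$. A segment $[a,b]$ with $a<b$ in $\mathbb{Z}\setminus\{0\}$ is $\{z\in\mathbb{Z}\setminus\{0\}\mid a\le z\le b\}$, with end points $a,b$. $[a,b]$ encloses $[c,d]$ when $a<c$ and $d<b$. A set of segments is nonoverlapping when every two distinct segments in it are either disjoint or one encloses the other. It exhausts $\mathbb{Z}\setminus\{0\}$ when every element of $\mathbb{Z}\setminus\{0\}$ is an end point of some segment in it. A segment $[a,b]$ is transversal when $a<0<b$, a cup when $0<a<b$, a cap when $a<b<0$. A frieze is a set of nonoverlapping segments exhausting $\mathbb{Z}\setminus\{0\}$ whose cups are all of the form $[2k+2,2k+3]$ and whose caps are all of the form $[-(2k+2),-(2k+1)]$, with $k\in\mathbb{N}$. Composition $D_2\circ D_1$ is obtained by putting the diagram of $D_2$ below the diagram of $D_1$: take three disjoint copies of the positive integers (top, middle, bottom points); regard each segment of $D_1$ as an edge, a positive end point $k$ being the top point $k$ and a negative end point $-k$ being the middle point $k$; regard each segment of $D_2$ as an edge, a positive end point $k$ being the middle point $k$ and a negative end point $-k$ being the bottom point $k$. The segments of $D_2\circ D_1$ join those pairs of distinct points among top points $k$ (read as $k$) and bottom points $k$ (read as $-k$) that are connected by a path in this graph. The composition of friezes is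 a frieze. In a frieze the end points of a transversal segment are either both odd (odd transversal segment) or both even. The successor of a transversal segment is the transversal segment with the next larger positive end point. A transversal pair consists of an odd transversal segment $[-(2k_1+1),2k_2+1]$ and its successor, which is of the form $[-(2k_1+2),2k_2+2k_3+2]$; it covers $n\in\mathbb{N}$ when $k_2\le n\le k_2+k_3$, and it assigns $k_1$ to each such $n$. In every frieze every $n\in\mathbb{N}$ is covered by exactly one transversal pair. *)

(* Defs.v *)
From Stdlib Require Import ZArith Relations ClassicalEpsilon.

Open Scope Z_scope.

(* The segment [a,b] is represented by the pair (a, b) of its end points. *)
Definition is_segment (s : Z * Z) : Prop :=
  fst s <> 0 /\ snd s <> 0 /\ fst s < snd s.

Definition in_segment (z : Z) (s : Z * Z) : Prop :=
  z <> 0 /\ fst s <= z <= snd s.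

Definition end_point (z : Z) (s : Z * Z) : Prop := z = fst s \/ z = snd s.

Definition encloses (s t : Z * Z) : Prop := fst s < fst t /\ snd t < snd s.

Definition disjoint (s t : Z * Z) : Prop :=
  forall z, ~ (in_segment z s /\ in_segment z t).

Definition nonoverlapping (D : Z * Z -> Prop) : Prop :=
  forall s t, D s -> D t -> s <> t ->
    disjoint s t \/ encloses s t \/ encloses t s.

Definition exhausting (D : Z * Z -> Prop) : Prop :=
  forall z, z <> 0 -> exists s, D s /\ end_point z s.

Definition transversal (s : Z * Z) : Prop := fst s < 0 < snd s.
Definition cup (s : Z * Z) : Prop := 0 < fst s < snd s.
Definition cap (s : Z * Z) : Prop := fst s < snd s < 0.

Record frieze (D : Z * Z -> Prop) : Prop := {
  frieze_segments : forall s, D s -> is_segment s;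
  frieze_nonoverlapping : nonoverlapping D;
  frieze_exhausting : exhausting D;
  frieze_cups : forall s, D s -> cup s ->
    exists k : nat, s = (2 * Z.of_nat k + 2, 2 * Z.of_nat k + 3);
  frieze_caps : forall s, D s -> cap s ->
    exists k : nat, s = (- (2 * Z.of_nat k + 2), - (2 * Z.of_nat k + 1))
}.

Inductive point : Set :=
| Top (k : positive)
| Middle (k : positive)
| Bottom (k : positive).

(* [placed upper lower z p]: p is the point denoted by the end point z in a
   diagram whose positive end points lie in the copy [upper] and whose negative
   end points lie in the copy [lower]; 0 denotes no point. *)
Inductive placed (upper lower : positive -> point) : Z -> point -> Prop :=
| placed_upper k : placed upper lower (Zpos k) (upper k)
| placed_lower k : placed upper lower (Zneg k) (lower k).

Inductive edge (D2 D1 : Z * Z -> Prop) (p q : point) : Prop :=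
| edge_first a b :
    D1 (a, b) -> placed Top Middle a p -> placed Top Middle b q ->
    edge D2 D1 p q
| edge_second a b :
    D2 (a, b) -> placed Middle Bottom a p -> placed Middle Bottom b q ->
    edge D2 D1 p q.

(* [edge] is oriented by the order of end points; paths ignore orientation. *)
Definition connected (D2 D1 : Z * Z -> Prop) : relation point :=
  clos_refl_sym_trans point (edge D2 D1).

(* [frieze_comp D2 D1] is D2 o D1, with D1 on top. *)
Definition frieze_comp (D2 D1 : Z * Z -> Prop) (s : Z * Z) : Prop :=
  fst s < snd s /\
  exists p q, placed Top Bottom (fst s) p /\ placed Top Bottom (snd s) q /\
    connected D2 D1 p q.

Definition odd_transversal (s : Z * Z) : Prop :=
  transversal s /\ Z.Odd (fst s) /\ Z.Odd (snd s).

Definition successor (D : Z * Z -> Prop) (s t : Z * Z) : Prop :=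
  D t /\ transversal t /\ snd s < snd t /\
  forall u, D u -> transversal u -> snd s < snd u -> snd t <= snd u.

Definition transversal_pair (D : Z * Z -> Prop) (s t : Z * Z) : Prop :=
  D s /\ odd_transversal s /\ successor D s t.

(* Some transversal pair of D covers n and assigns k1 to it. *)
Definition assigned (D : Z * Z -> Prop) (n k1 : nat) : Prop :=
  exists (s t : Z * Z) (k2 k3 : nat),
    transversal_pair D s t /\
    s = (- (2 * Z.of_nat k1 + 1), 2 * Z.of_nat k2 + 1) /\
    t = (- (2 * Z.of_nat k1 + 2), 2 * Z.of_nat k2 + 2 * Z.of_nat k3 + 2) /\
    (k2 <= n <= k2 + k3)%nat.

Definition order_preserving (f : nat -> nat) : Prop :=
  forall m n, (m <= n)%nat -> (f m <= f n)%nat.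

(* For a frieze D, exactly one function satisfies the description, because
   every n is covered by exactly one transversal pair. The value is unspecified
   when no function does. *)
Definition phi (D : Z * Z -> Prop) : nat -> nat :=
  epsilon (inhabits (fun _ : nat => 0%nat))
    (fun f => order_preserving f /\ forall n, assigned D n (f n)).

(* Main.v *)
Require Import Defs.
From Stdlib Require Import ZArith Basics Lia Relations Classical ClassicalEpsilon
  FunctionalExtensionality.

(** Regard a frieze [D] as a diagram in a horizontal strip, the positive end
points on the top line and the negative ones on the bottom line.  On either line
the interval [n] between the points 2n+1 and 2n+2 is shaded, and the interval
[n] just to the left of the point 2n+1 is unshaded (for n = 0 it is unbounded).
The segments of [D] cut the strip into shaded and unshaded regions.  Cups and
caps being short, every shaded region reaches exactly one interval of the bottom
line and every unshaded region exactly one interval of the top line; so shaded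
regions can be named by bottom intervals and unshaded ones by top intervals.
The shaded top interval [n] lies in the region [h n], the unshaded bottom
interval [j] lies in the region [e j], and planarity says that [h] and [e] are
adjoint: [e j <= n] iff [j <= h n].

Each segment separates one shaded region from one unshaded region, and this pair
of regions determines it.  Hence two points are joined by a segment of [D] iff
they border on the same two regions ([frieze_described]), so that [D] can be
recovered from [h] and [e].  Reading off the transversal pairs gives
[phi D = h] ([phi_described]).

In a composite, a region of [D1] passes into a region of [D2] through an
interval of the middle line.  The name of the shaded region at a point is pushed
down to the bottom line by [h2], the name of the unshaded region is pulled up to
the top line by [e1].  The resulting pair of names is constant along paths, and
conversely points with the same pair are connected; so [D2] after [D1] is
described by [h2] after [h1] together with [e1] after [e2]
([described_comp]). *)

(** * Regions *)

Definition adjoint (e h : nat -> nat) : Prop :=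
  forall j n, (e j <= n <-> j <= h n)%nat.

(** The intervals of the line of [z] on the two sides of [z]: the points 2n+1 and
2n+2 both border on the shaded interval [n], whereas 2n+2 and 2n+3 both border on
the unshaded interval [n+1]. *)
Definition shaded (z : Z) : nat := Z.to_nat ((Z.abs z - 1) / 2).
Definition unshaded (z : Z) : nat := Z.to_nat (Z.abs z / 2).

(** The shaded region at [z], named by its bottom interval, and the unshaded one,
named by its top interval. *)
Definition regions (e h : nat -> nat) (z : Z) : nat * nat :=
  if 0 <? z then (h (shaded z), unshaded z) else (shaded z, e (unshaded z)).

Definition same_regions (e h : nat -> nat) (s : Z * Z) : Prop :=
  is_segment s /\ regions e h (fst s) = regions e h (snd s).

(** [D] consists of all the segments whose two ends border on the same regions. *)
Definition described (D : Z * Z -> Prop) (e h : nat -> nat) : Prop :=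
  adjoint e h /\ forall s, D s <-> same_regions e h s.

Lemma shaded_odd z n : Z.abs z = 2 * Z.of_nat n + 1 -> shaded z = n.
Proof. unfold shaded; intros ->. Z.to_euclidean_division_equations; lia. Qed.

Lemma shaded_even z n : Z.abs z = 2 * Z.of_nat n + 2 -> shaded z = n.
Proof. unfold shaded; intros ->. Z.to_euclidean_division_equations; lia. Qed.

Lemma unshaded_odd z n : Z.abs z = 2 * Z.of_nat n + 1 -> unshaded z = n.
Proof. unfold unshaded; intros ->. Z.to_euclidean_division_equations; lia. Qed.

Lemma unshaded_even z n : Z.abs z = 2 * Z.of_nat n + 2 -> unshaded z = S n.
Proof. unfold unshaded; intros ->. Z.to_euclidean_division_equations; lia. Qed.

Lemma abs_parity z : z <> 0 ->
  (exists n : nat, Z.abs z = 2 * Z.of_nat n + 1) \/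
  (exists n : nat, Z.abs z = 2 * Z.of_nat n + 2).
Proof.
  intros hz. destruct (Z.Even_or_Odd (Z.abs z)) as [[m hm] | [m hm]].
  - right. exists (Z.to_nat (m - 1)). lia.
  - left. exists (Z.to_nat m). lia.
Qed.

Lemma region_indices z : z <> 0 ->
  exists m i : nat, shaded z = m /\ unshaded z = i /\
    (Z.abs z = 2 * Z.of_nat m + 1 /\ i = m \/
     Z.abs z = 2 * Z.of_nat m + 2 /\ i = S m).
Proof.
  intros hz. destruct (abs_parity z hz) as [[n hn] | [n hn]].
  - exists n, n. rewrite (shaded_odd _ _ hn), (unshaded_odd _ _ hn). auto.
  - exists n, (S n). rewrite (shaded_even _ _ hn), (unshaded_even _ _ hn). auto.
Qed.

Lemma regions_top e h z : 0 < z -> regions e h z = (h (shaded z), unshaded z).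
Proof. intros hz. unfold regions. destruct (Z.ltb_spec 0 z); [easy | lia]. Qed.

Lemma regions_bottom e h z :
  z < 0 -> regions e h z = (shaded z, e (unshaded z)).
Proof. intros hz. unfold regions. destruct (Z.ltb_spec 0 z); [lia | easy]. Qed.

Lemma adjoint_mono e h : adjoint e h ->
  forall m n, (m <= n)%nat -> (h m <= h n)%nat.
Proof. intros A m n mn. apply A. apply (Nat.le_trans _ m); [apply A|]; lia. Qed.

Lemma adjoint_mono_l e h : adjoint e h ->
  forall i j, (i <= j)%nat -> (e i <= e j)%nat.
Proof. intros A i j ij. apply A. apply (Nat.le_trans _ j); [|apply A]; lia. Qed.

Lemma adjoint_compose e1 h1 e2 h2 : adjoint e1 h1 -> adjoint e2 h2 ->
  adjoint (compose e1 e2) (compose h2 h1).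
Proof. intros A1 A2 j n. unfold compose. rewrite (A1 (e2 j) n). apply A2. Qed.

(** The left adjoint of [h] sends [j] to the least [n] with [j <= h n]. *)
Lemma adjoint_exists (h : nat -> nat) :
  (forall m n, (m <= n)%nat -> (h m <= h n)%nat) ->
  (forall j, exists n, (j <= h n)%nat) ->
  exists e, adjoint e h.
Proof.
  intros mono unb.
  assert (L : forall j, exists n, forall m, (n <= m <-> j <= h m)%nat).
  { intros j. destruct (unb j) as [n hn]. revert hn.
    induction n as [|n IH]; intros hn.
    - exists 0%nat. intros m. split; [|lia]. intros hm. specialize (mono _ _ hm). lia.
    - destruct (Nat.le_gt_cases j (h n)) as [c | c]; [auto|].
      exists (S n). intros m. split; intros hm.
      + specialize (mono _ _ hm). lia.
      + destruct (Nat.le_gt_cases (S n) m) as [|c']; [assumption|].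
        specialize (mono m n ltac:(lia)). lia. }
  exists (fun j => proj1_sig (constructive_indefinite_description _ (L j))).
  intros j n. destruct (constructive_indefinite_description _ (L j)); simpl; auto.
Qed.

(** Two regions have at most one segment in common.  The name of the unshaded
region leaves only the top points 2i and 2i+1, the name of the shaded one only
the bottom points 2m+1 and 2m+2.  If both points of one of these pairs border on
the two regions then, by adjointness, no point of the other pair does. *)
Lemma no_three_same_regions e h x y z : adjoint e h ->
  x <> 0 -> y <> 0 -> z <> 0 ->
  regions e h x = regions e h y -> regions e h x = regions e h z ->
  x = y \/ x = z \/ y = z.
Proof.
  intros A hx hy hz.
  destruct (region_indices x hx) as (m & i & ex & ux & cx).
  destruct (region_indices y hy) as (m' & i' & ey & uy & cy).
  destruct (region_indices z hz) as (m'' & i'' & ez & uz & cz).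
  unfold regions. rewrite ex, ux, ey, uy, ez, uz.
  destruct (Z.ltb_spec 0 x), (Z.ltb_spec 0 y), (Z.ltb_spec 0 z);
    intros [= E1 E2] [= E3 E4]; try lia;
    destruct cx as [[? ->] | [? ->]], cy as [[? ->] | [? ->]],
      cz as [[? ->] | [? ->]]; try lia;
    (* Adjointness is used at all the indices that occur. *)
    repeat match goal with
    | _ : context [e ?j], _ : context [h ?n] |- _ =>
        lazymatch goal with
        | _ : (e j <= n <-> j <= h n)%nat |- _ => fail
        | _ => pose proof (A j n)
        end
    end; subst; lia.
Qed.

(** * The function of a described diagram *)

Lemma regions_top_odd e h n : regions e h (2 * Z.of_nat n + 1) = (h n, n).
Proof.
  rewrite regions_top by lia.
  rewrite (shaded_odd _ n), (unshaded_odd _ n) by lia. reflexivity.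
Qed.

Lemma regions_top_even e h n : regions e h (2 * Z.of_nat n + 2) = (h n, S n).
Proof.
  rewrite regions_top by lia.
  rewrite (shaded_even _ n), (unshaded_even _ n) by lia. reflexivity.
Qed.

Lemma regions_bottom_odd e h n : regions e h (- (2 * Z.of_nat n + 1)) = (n, e n).
Proof.
  rewrite regions_bottom by lia.
  rewrite (shaded_odd _ n), (unshaded_odd _ n) by lia. reflexivity.
Qed.

Lemma regions_bottom_even e h n :
  regions e h (- (2 * Z.of_nat n + 2)) = (n, e (S n)).
Proof.
  rewrite regions_bottom by lia.
  rewrite (shaded_even _ n), (unshaded_even _ n) by lia. reflexivity.
Qed.

(** The top intervals [n] with [h n = k1] are those from [e k1] up to, but not
including, [e (k1 + 1)]; the boundary of the shaded region [k1] starts at the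
left end of the first of them and ends at the right end of the last.  Every point
strictly between these ends borders on the region [k1] and on an unshaded region
which does not reach the bottom line, so no transversal segment ends there. *)
Lemma assigned_described D e h n : described D e h -> assigned D n (h n).
Proof.
  intros [A H].
  pose proof (A (h n) n). pose proof (A (S (h n)) n).
  pose proof (adjoint_mono _ _ A) as M.
  remember (h n) as k1 eqn:ek1. remember (e k1) as k2 eqn:ek2.
  remember (e (S k1)) as l eqn:el.
  assert (l1 : (k2 <= n < l)%nat) by lia.
  assert (E : forall i, (k2 <= i < l)%nat -> h i = k1).
  { intros i hi. pose proof (A k1 i). pose proof (A (S k1) i). lia. }
  assert (Dt : D (- (2 * Z.of_nat k1 + 2),
                  2 * Z.of_nat k2 + 2 * Z.of_nat (l - 1 - k2) + 2)).
  { apply H. split; [unfold is_segment; cbn [fst snd]; lia|]. cbn [fst snd].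
    replace (2 * Z.of_nat k2 + 2 * Z.of_nat (l - 1 - k2) + 2)
      with (2 * Z.of_nat (l - 1) + 2) by lia.
    rewrite regions_bottom_even, regions_top_even, E by lia.
    f_equal. lia. }
  exists (- (2 * Z.of_nat k1 + 1), 2 * Z.of_nat k2 + 1), (- (2 * Z.of_nat k1 + 2),
    2 * Z.of_nat k2 + 2 * Z.of_nat (l - 1 - k2) + 2), k2, (l - 1 - k2)%nat.
  split; [|split; [reflexivity | split; [reflexivity | lia]]].
  split; [|split].
  - apply H. split; [unfold is_segment; cbn [fst snd]; lia|]. cbn [fst snd].
    rewrite regions_bottom_odd, regions_top_odd, E by lia. congruence.
  - split; [unfold transversal; cbn [fst snd]; lia|]. cbn [fst snd]. split.
    + exists (- Z.of_nat k1 - 1). lia.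
    + exists (Z.of_nat k2). lia.
  - split; [exact Dt|]. split; [unfold transversal; cbn [fst snd]; lia|].
    split; [cbn [fst snd]; lia|].
    intros [a b] Du [ha hb] lb; cbn [fst snd] in *.
    apply H in Du. destruct Du as [_ Eu]; cbn [fst snd] in Eu.
    destruct (region_indices b ltac:(lia)) as (m & i & eb & ub & cb).
    destruct (region_indices a ltac:(lia)) as (m' & i' & ea & ua & ca).
    rewrite regions_bottom, regions_top, ea, ua, eb, ub in Eu by lia.
    injection Eu as E1 E2.
    destruct (Nat.le_gt_cases l i) as [c | c]; [lia|].
    (* Otherwise the shaded region of b is k1, and both choices for the unshaded
       region of a lie outside the range of that of b. *)
    rewrite (E m) in E1 by lia.
    assert (i' = k1 \/ i' = S k1) as [-> | ->] by lia; lia.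
Qed.

(** Both segments of the pair border on the shaded region [k1], which gives
[h k2 = k1 = h (k2 + k3)]; monotonicity does the rest. *)
Lemma assigned_described_unique D e h n k :
  described D e h -> assigned D n k -> k = h n.
Proof.
  intros [A H] (s & t & k2 & k3 & [Ds [_ [Dt _]]] & -> & -> & hn).
  apply H in Ds, Dt. destruct Ds as [_ Es], Dt as [_ Et]. cbn [fst snd] in Es, Et.
  replace (2 * Z.of_nat k2 + 2 * Z.of_nat k3 + 2)
    with (2 * Z.of_nat (k2 + k3) + 2) in Et by lia.
  rewrite regions_bottom_odd, regions_top_odd in Es.
  rewrite regions_bottom_even, regions_top_even in Et.
  injection Es as E1 _. injection Et as E2 _.
  pose proof (adjoint_mono _ _ A k2 n). pose proof (adjoint_mono _ _ A n (k2 + k3)).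
  lia.
Qed.

Lemma phi_described D e h : described D e h -> phi D = h.
Proof.
  intros d. unfold phi.
  match goal with |- epsilon ?i ?P = _ =>
    assert (S : P (epsilon i P)) end.
  { apply epsilon_spec. exists h. split.
    - exact (adjoint_mono _ _ (proj1 d)).
    - intros n. exact (assigned_described _ _ _ n d). }
  apply functional_extensionality. intros n.
  exact (assigned_described_unique _ _ _ _ _ d (proj2 S n)).
Qed.

(** * Composition *)

(** The regions of a composite at a point, named by intervals of the outer lines. *)
Definition point_regions (e1 h1 e2 h2 : nat -> nat) (p : point) : nat * nat :=
  match p with
  | Top k => (h2 (h1 (shaded (Zpos k))), unshaded (Zpos k))
  | Middle k => (h2 (shaded (Zpos k)), e1 (unshaded (Zpos k)))
  | Bottom k => (shaded (Zpos k), e1 (e2 (unshaded (Zpos k))))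
  end.

Lemma point_regions_edge D1 D2 e1 h1 e2 h2 p q :
  described D1 e1 h1 -> described D2 e2 h2 -> edge D2 D1 p q ->
  point_regions e1 h1 e2 h2 p = point_regions e1 h1 e2 h2 q.
Proof.
  intros [_ H1] [_ H2] [a b Dab pa pb | a b Dab pa pb].
  - apply H1 in Dab. destruct Dab as [_ E]. simpl in E.
    destruct pa, pb; injection E as E E'; simpl;
      unfold shaded, unshaded in *; simpl in *; congruence.
  - apply H2 in Dab. destruct Dab as [_ E]. simpl in E.
    destruct pa, pb; injection E as E E'; simpl;
      unfold shaded, unshaded in *; simpl in *; congruence.
Qed.

Lemma point_regions_connected D1 D2 e1 h1 e2 h2 p q :
  described D1 e1 h1 -> described D2 e2 h2 -> connected D2 D1 p q ->
  point_regions e1 h1 e2 h2 p = point_regions e1 h1 e2 h2 q.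
Proof.
  intros d1 d2 c. induction c; [|congruence..].
  eapply point_regions_edge; eassumption.
Qed.

Lemma point_regions_placed e1 h1 e2 h2 z p : placed Top Bottom z p ->
  point_regions e1 h1 e2 h2 p = regions (compose e1 e2) (compose h2 h1) z.
Proof. intros []; reflexivity. Qed.

Lemma placed_exists upper lower z : z <> 0 -> exists p, placed upper lower z p.
Proof. destruct z as [|k|k]; [easy | eexists; constructor..]. Qed.

Lemma placed_nonzero upper lower z p : placed upper lower z p -> z <> 0.
Proof. now intros []. Qed.

(** Neighbouring points k and k+1 share the interval between them.  If this is
shaded, equality of the unshaded regions means that [D1] has a cap there; if it
is unshaded, equality of the shaded regions means that [D2] has a cup there. *)
Lemma middle_step D1 D2 e1 h1 e2 h2 k :
  described D1 e1 h1 -> described D2 e2 h2 ->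
  point_regions e1 h1 e2 h2 (Middle k) =
    point_regions e1 h1 e2 h2 (Middle (Pos.succ k)) ->
  connected D2 D1 (Middle k) (Middle (Pos.succ k)).
Proof.
  intros [_ H1] [_ H2] [= E1 E2].
  destruct (region_indices (Zpos k) ltac:(lia)) as (m & i & ek & uk & ck).
  destruct (region_indices (Zpos (Pos.succ k)) ltac:(lia)) as (m' & i' & ek' & uk' & ck').
  rewrite ek, ek' in E1. rewrite uk, uk' in E2.
  destruct ck as [[ck ->] | [ck ->]], ck' as [[ck' ->] | [ck' ->]]; try lia.
  - apply rst_sym, rst_step.
    eapply (edge_first _ _ _ _ (Zneg (Pos.succ k)) (Zneg k)); [|constructor..].
    apply H1. split; [unfold is_segment; cbn [fst snd]; lia|]. cbn [fst snd].
    unfold regions; simpl. unfold shaded, unshaded in *; simpl Z.abs in *.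
    f_equal; congruence || lia.
  - apply rst_step.
    eapply (edge_second _ _ _ _ (Zpos k) (Zpos (Pos.succ k))); [|constructor..].
    apply H2. split; [unfold is_segment; cbn [fst snd]; lia|]. cbn [fst snd].
    unfold regions; simpl. unfold shaded, unshaded in *; simpl Z.abs in *.
    f_equal; congruence || lia.
Qed.

Lemma shaded_mono x y : 0 < x -> x <= y -> (shaded x <= shaded y)%nat.
Proof. unfold shaded. intros. Z.to_euclidean_division_equations; lia. Qed.

Lemma unshaded_mono x y : 0 < x -> x <= y -> (unshaded x <= unshaded y)%nat.
Proof. unfold unshaded. intros. Z.to_euclidean_division_equations; lia. Qed.

(** Both names increase weakly along the middle line, so they are constant between
two points where they agree, and one can walk there by steps to neighbours. *)
Lemma middle_connected_le D1 D2 e1 h1 e2 h2 :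
  described D1 e1 h1 -> described D2 e2 h2 ->
  forall k l, (k <= l)%positive ->
  point_regions e1 h1 e2 h2 (Middle k) = point_regions e1 h1 e2 h2 (Middle l) ->
  connected D2 D1 (Middle k) (Middle l).
Proof.
  intros d1 d2 k l. revert k. induction l as [|l IH] using Pos.peano_ind; intros k kl E.
  - replace k with 1%positive by lia. apply rst_refl.
  - destruct (Pos.eq_dec k (Pos.succ l)) as [-> | ne]; [apply rst_refl|].
    assert (kl' : (k <= l)%positive) by lia.
    assert (E' : point_regions e1 h1 e2 h2 (Middle k) =
                 point_regions e1 h1 e2 h2 (Middle l)).
    { injection E as E1 E2. simpl.
      pose proof (adjoint_mono _ _ (proj1 d2)) as M.
      pose proof (adjoint_mono_l _ _ (proj1 d1)) as N.
      pose proof (M _ _ (shaded_mono (Zpos k) (Zpos l) ltac:(lia) ltac:(lia))).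
      pose proof (M _ _ (shaded_mono (Zpos l) (Zpos (Pos.succ l)) ltac:(lia) ltac:(lia))).
      pose proof (N _ _ (unshaded_mono (Zpos k) (Zpos l) ltac:(lia) ltac:(lia))).
      pose proof (N _ _ (unshaded_mono (Zpos l) (Zpos (Pos.succ l))
        ltac:(lia) ltac:(lia))).
      f_equal; lia. }
    apply rst_trans with (Middle l); [exact (IH k kl' E')|].
    apply (middle_step _ _ e1 h1 e2 h2); [assumption..|congruence].
Qed.

Lemma middle_connected D1 D2 e1 h1 e2 h2 k l :
  described D1 e1 h1 -> described D2 e2 h2 ->
  point_regions e1 h1 e2 h2 (Middle k) = point_regions e1 h1 e2 h2 (Middle l) ->
  connected D2 D1 (Middle k) (Middle l).
Proof.
  intros d1 d2 E. destruct (Pos.leb_spec k l) as [c | c].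
  - exact (middle_connected_le _ _ _ _ _ _ d1 d2 k l c E).
  - apply rst_sym.
    exact (middle_connected_le _ _ _ _ _ _ d1 d2 l k (Pos.lt_le_incl _ _ c) (eq_sym E)).
Qed.

Lemma joined_exists D e h z : described D e h -> exhausting D -> z <> 0 ->
  exists z', z' <> 0 /\ z' <> z /\ (D (z, z') \/ D (z', z)).
Proof.
  intros [_ H] X hz. destruct (X z hz) as [[a b] [Ds [E | E]]]; simpl in E; subst.
  - exists b. pose proof (proj1 (H _) Ds) as [[? [? ?]] _]. simpl in *. auto with zarith.
  - exists a. pose proof (proj1 (H _) Ds) as [[? [? ?]] _]. simpl in *.
    split; [auto|]. split; [lia | auto].
Qed.

(** Only the first edge of a path is needed: it either leads to the middle line or
returns to the same outer line. *)
Lemma outer_neighbour D1 D2 e1 h1 e2 h2 z p :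
  described D1 e1 h1 -> described D2 e2 h2 ->
  exhausting D1 -> exhausting D2 -> placed Top Bottom z p ->
  (exists k, connected D2 D1 p (Middle k)) \/
  exists z' q, z' <> z /\ placed Top Bottom z' q /\ connected D2 D1 p q.
Proof.
  intros d1 d2 X1 X2 [k | k].
  - destruct (joined_exists _ _ _ (Zpos k) d1 X1 ltac:(easy)) as (z' & nz & ne & j).
    destruct z' as [|l|l]; [easy| |].
    + right. exists (Zpos l), (Top l). split; [assumption|]. split; [constructor|].
      destruct j as [j | j]; [|apply rst_sym]; apply rst_step;
        (eapply edge_first; [exact j | constructor..]).
    + left. exists l.
      destruct j as [j | j]; [|apply rst_sym]; apply rst_step;
        (eapply edge_first; [exact j | constructor..]).
  - destruct (joined_exists _ _ _ (Zneg k) d2 X2 ltac:(easy)) as (z' & nz & ne & j).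
    destruct z' as [|l|l]; [easy| |].
    + left. exists l.
      destruct j as [j | j]; [|apply rst_sym]; apply rst_step;
        (eapply edge_second; [exact j | constructor..]).
    + right. exists (Zneg l), (Bottom l). split; [assumption|]. split; [constructor|].
      destruct j as [j | j]; [|apply rst_sym]; apply rst_step;
        (eapply edge_second; [exact j | constructor..]).
Qed.

Lemma placed_functional upper lower z p q :
  placed upper lower z p -> placed upper lower z q -> p = q.
Proof. intros []; inversion 1; reflexivity. Qed.

(** Connected points have the same regions since edges preserve them.  Conversely
let two outer points have the same regions.  If one of them is joined by an edge
to an outer point, that point has the same regions, hence is the other one.  If
both are joined to middle points, these have the same regions, hence are
connected. *)
Lemma described_comp D1 D2 e1 h1 e2 h2 :
  described D1 e1 h1 -> described D2 e2 h2 -> exhausting D1 -> exhausting D2 ->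
  described (frieze_comp D2 D1) (compose e1 e2) (compose h2 h1).
Proof.
  intros d1 d2 X1 X2.
  pose proof (adjoint_compose _ _ _ _ (proj1 d1) (proj1 d2)) as A.
  split; [exact A|]. intros [a b]. split.
  - intros [ab (p & q & pa & qb & c)]; simpl in *. split.
    + split; [|split]; simpl; eauto using placed_nonzero.
    + simpl. rewrite <- (point_regions_placed _ _ _ _ _ _ pa),
        <- (point_regions_placed _ _ _ _ _ _ qb).
      exact (point_regions_connected _ _ _ _ _ _ _ _ d1 d2 c).
  - intros [[na [nb ab]] E]; simpl in *. split; [assumption|]. cbn [fst snd].
    destruct (placed_exists Top Bottom a na) as [p pa].
    destruct (placed_exists Top Bottom b nb) as [q qb].
    exists p, q. split; [assumption|]. split; [assumption|].
    assert (only : forall x y z' r s,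
       placed Top Bottom x r -> placed Top Bottom y s -> x <> y ->
       regions (compose e1 e2) (compose h2 h1) x =
         regions (compose e1 e2) (compose h2 h1) y ->
       (exists r', z' <> x /\ placed Top Bottom z' r' /\ connected D2 D1 r r') ->
       connected D2 D1 r s).
    { intros x y z' r s xr ys xy Exy (r' & zx & zr & c).
      pose proof (point_regions_connected _ _ _ _ _ _ _ _ d1 d2 c) as Ec.
      rewrite (point_regions_placed _ _ _ _ _ _ xr),
        (point_regions_placed _ _ _ _ _ _ zr) in Ec.
      destruct (no_three_same_regions _ _ x y z' A) as [|[|]]; eauto using placed_nonzero;
        [congruence.. |].
      subst z'. now rewrite (placed_functional _ _ _ _ _ ys zr). }
    destruct (outer_neighbour _ _ _ _ _ _ a p d1 d2 X1 X2 pa) as [[k ck] | (z' & r & cz)].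
    + destruct (outer_neighbour _ _ _ _ _ _ b q d1 d2 X1 X2 qb)
        as [[l cl] | (z' & r & cz)].
      * apply rst_trans with (Middle k); [assumption|].
        apply rst_trans with (Middle l); [|now apply rst_sym].
        apply (middle_connected _ _ e1 h1 e2 h2); [assumption..|].
        rewrite <- (point_regions_connected _ _ _ _ _ _ _ _ d1 d2 ck),
          <- (point_regions_connected _ _ _ _ _ _ _ _ d1 d2 cl),
          (point_regions_placed _ _ _ _ _ _ pa), (point_regions_placed _ _ _ _ _ _ qb).
        exact E.
      * apply rst_sym. apply (only b a z'); eauto. lia.
    + apply (only a b z'); eauto. lia.
Qed.

(** * Every frieze is described *)

(** A transversal segment, given by the distances of its end points from 0. *)
Definition crossing (D : Z * Z -> Prop) (a b : Z) : Prop :=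
  0 < a /\ 0 < b /\ D (- a, b).

(** Segments with a common end point are not disjoint, and enclosure is strict at
both ends. *)
Lemma end_point_unique D s t z : frieze D -> D s -> D t ->
  end_point z s -> end_point z t -> s = t.
Proof.
  intros F Ds Dt zs zt. apply NNPP. intros ne.
  pose proof (frieze_segments D F s Ds) as [? [? ?]].
  pose proof (frieze_segments D F t Dt) as [? [? ?]].
  destruct (frieze_nonoverlapping D F s t Ds Dt ne) as [N | [[? ?] | [? ?]]];
    unfold end_point in *; [|lia..].
  apply (N z). unfold in_segment. lia.
Qed.

(** Transversal segments all contain 1, so of two different ones one encloses the
other. *)
Lemma crossing_order D a b c d : frieze D -> crossing D a b -> crossing D c d ->
  (a < c /\ b < d) \/ (c < a /\ d < b) \/ (a = c /\ b = d).
Proof.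
  intros F (a0 & b0 & Dab) (c0 & d0 & Dcd).
  destruct (Z.eq_dec a c) as [E | ne].
  - assert (E' : (- a, b) = (- c, d)).
    { apply (end_point_unique D _ _ (- a) F Dab Dcd); unfold end_point; simpl; lia. }
    injection E'. lia.
  - assert (ne' : (- a, b) <> (- c, d)) by (intros [= ? ?]; lia).
    destruct (frieze_nonoverlapping D F _ _ Dab Dcd ne') as [N | [[? ?] | [? ?]]];
      simpl in *; [|lia..].
    exfalso. apply (N 1). unfold in_segment; simpl. lia.
Qed.

Lemma top_end D b : frieze D -> 0 < b ->
  (exists a, crossing D a b) \/
  exists n : nat, D (2 * Z.of_nat n + 2, 2 * Z.of_nat n + 3) /\
    (b = 2 * Z.of_nat n + 2 \/ b = 2 * Z.of_nat n + 3).
Proof.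
  intros F b0. destruct (frieze_exhausting D F b ltac:(lia)) as [[x y] [Ds E]].
  pose proof (frieze_segments D F _ Ds) as [? [? ?]].
  unfold end_point in E. cbn [fst snd] in *.
  destruct (Z.ltb_spec 0 x) as [c | c].
  - right. destruct (frieze_cups D F _ Ds) as [n En]; [unfold cup; simpl; lia|].
    exists n. split; [now rewrite <- En | apply pair_equal_spec in En; lia].
  - left. exists (- x). unfold crossing. replace (- - x) with x by lia.
    assert (b = y) as -> by lia. repeat split; [lia.. | assumption].
Qed.

Lemma bottom_end D a : frieze D -> 0 < a ->
  (exists b, crossing D a b) \/
  exists n : nat, D (- (2 * Z.of_nat n + 2), - (2 * Z.of_nat n + 1)) /\
    (a = 2 * Z.of_nat n + 2 \/ a = 2 * Z.of_nat n + 1).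
Proof.
  intros F a0. destruct (frieze_exhausting D F (- a) ltac:(lia)) as [[x y] [Ds E]].
  pose proof (frieze_segments D F _ Ds) as [? [? ?]].
  unfold end_point in E. cbn [fst snd] in *.
  destruct (Z.ltb_spec y 0) as [c | c].
  - right. destruct (frieze_caps D F _ Ds) as [n En]; [unfold cap; simpl; lia|].
    exists n. split; [now rewrite <- En | apply pair_equal_spec in En; lia].
  - left. exists y. unfold crossing.
    assert (- a = x) as -> by lia. repeat split; [lia.. | assumption].
Qed.

Lemma crossing_not_cup D a b (n : nat) : frieze D -> crossing D a b ->
  D (2 * Z.of_nat n + 2, 2 * Z.of_nat n + 3) ->
  b <> 2 * Z.of_nat n + 2 /\ b <> 2 * Z.of_nat n + 3.
Proof.
  intros F (? & ? & H) C.
  split; intros ->; pose proof (end_point_unique D _ _ _ F H C (or_intror eq_refl)) as E;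
    unfold end_point in E; cbn [fst snd] in E;
    specialize (E ltac:(lia)); apply pair_equal_spec in E; lia.
Qed.

Lemma crossing_not_cap D a b (n : nat) : frieze D -> crossing D a b ->
  D (- (2 * Z.of_nat n + 2), - (2 * Z.of_nat n + 1)) ->
  a <> 2 * Z.of_nat n + 2 /\ a <> 2 * Z.of_nat n + 1.
Proof.
  intros F (? & ? & H) C.
  split; intros ->; pose proof (end_point_unique D _ _ _ F H C (or_introl eq_refl)) as E;
    unfold end_point in E; cbn [fst snd] in E;
    specialize (E ltac:(lia)); apply pair_equal_spec in E; lia.
Qed.

(** A cup uses up 2n+2 and 2n+3 together, so transversal segments end in both of
them or in neither. *)
Lemma top_partners D (n : nat) : frieze D ->
  (exists a, crossing D a (2 * Z.of_nat n + 2)) <->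
  (exists a, crossing D a (2 * Z.of_nat n + 3)).
Proof.
  intros F. split; intros [a C].
  - destruct (top_end D (2 * Z.of_nat n + 3) F ltac:(lia))
      as [|[m [H e]]]; [assumption|].
    destruct (crossing_not_cup D _ _ m F C H). lia.
  - destruct (top_end D (2 * Z.of_nat n + 2) F ltac:(lia))
      as [|[m [H e]]]; [assumption|].
    destruct (crossing_not_cup D _ _ m F C H). lia.
Qed.

(** Likewise for the two ends of a possible cap. *)
Lemma bottom_partners D (n : nat) : frieze D ->
  (exists b, crossing D (2 * Z.of_nat n + 1) b) <->
  (exists b, crossing D (2 * Z.of_nat n + 2) b).
Proof.
  intros F. split; intros [a C].
  - destruct (bottom_end D (2 * Z.of_nat n + 2) F ltac:(lia))
      as [|[m [H e]]]; [assumption|].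
    destruct (crossing_not_cap D _ _ m F C H). lia.
  - destruct (bottom_end D (2 * Z.of_nat n + 1) F ltac:(lia))
      as [|[m [H e]]]; [assumption|].
    destruct (crossing_not_cap D _ _ m F C H). lia.
Qed.

(** The shaded top interval [n] reaches the bottom interval [k]: the last
transversal segment to the left of the top interval [n] is odd and has the bottom
interval [k] on its right. *)
Definition last_crossing (D : Z * Z -> Prop) (n k : nat) : Prop :=
  exists j : nat, (j <= n)%nat /\
    crossing D (2 * Z.of_nat k + 1) (2 * Z.of_nat j + 1) /\
    forall a b, crossing D a b -> b <= 2 * Z.of_nat n + 1 ->
      b <= 2 * Z.of_nat j + 1.

(** The bottom partner 2k+2 of the last odd crossing is the end of a crossing, which
meets the top line at or after 2n+2; if it were after, the crossing at 2n+2 would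
need a bottom end strictly between 2k+1 and 2k+2. *)
Lemma crossing_even_after D n k a : frieze D -> last_crossing D n k ->
  crossing D a (2 * Z.of_nat n + 2) -> a = 2 * Z.of_nat k + 2.
Proof.
  intros F (j & jn & C & L) C'.
  destruct (proj1 (bottom_partners D k F) (ex_intro _ _ C)) as [b C''].
  destruct (crossing_order D _ _ _ _ F C C'') as [|[|]]; [|lia..].
  destruct (crossing_order D _ _ _ _ F C C') as [|[|]]; [|lia..].
  destruct (crossing_order D _ _ _ _ F C' C'') as [|[|]]; [lia| |lia].
  specialize (L _ _ C''). lia.
Qed.

(** If [c] were even, its partner [c - 1] would be the end of a crossing strictly
between the two given ones, whose top ends are neighbours. *)
Lemma crossing_odd_after D a b c d : frieze D ->
  crossing D (2 * Z.of_nat a + 2) b -> crossing D c d -> d = b + 1 ->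
  exists k : nat, c = 2 * Z.of_nat k + 1.
Proof.
  intros F C C' ->.
  destruct C' as (c0 & b0 & H).
  destruct (abs_parity c ltac:(lia)) as [[k hk] | [k hk]]; [exists k; lia|].
  assert (c = 2 * Z.of_nat k + 2) as -> by lia.
  pose proof (conj c0 (conj b0 H) : crossing D _ _) as C'.
  destruct (proj2 (bottom_partners D k F) (ex_intro _ _ C')) as [x C''].
  destruct (crossing_order D _ _ _ _ F C C') as [|[|]]; [|lia..].
  destruct (crossing_order D _ _ _ _ F C C'') as [|[|]];
    destruct (crossing_order D _ _ _ _ F C' C'') as [|[|]]; lia.
Qed.

(** Transversal segments are alternately odd and even from left to right: a new one
to the left of the top interval [n + 1] appears only together with one at 2n+2. *)
Lemma last_crossing_exists D n : frieze D -> exists k, last_crossing D n k.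
Proof.
  intros F. induction n as [|n [k L]].
  - destruct (top_end D 1 F ltac:(lia)) as [[c C] | [m [_ ?]]]; [|lia].
    destruct (abs_parity c) as [[k hk] | [k hk]]; [unfold crossing in C; lia|..].
    + exists k, 0%nat. split; [lia|]. split; [|intros; lia].
      replace (2 * Z.of_nat k + 1) with c by (unfold crossing in C; lia). exact C.
    + replace c with (2 * Z.of_nat k + 2) in C by (unfold crossing in C; lia).
      destruct (proj2 (bottom_partners D k F) (ex_intro _ _ C)) as [x C'].
      pose proof (crossing_order D _ _ _ _ F C C'). unfold crossing in C'. lia.
  - destruct (classic (exists a, crossing D a (2 * Z.of_nat n + 2))) as [[c C] | N].
    + pose proof (crossing_even_after D n k c F L C). subst c.
      destruct (proj1 (top_partners D n F) (ex_intro (fun a => crossing D a _) _ C))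
        as [c C'].
      destruct (crossing_odd_after D _ _ _ _ F C C' ltac:(lia)) as [k' ->].
      exists k', (S n). split; [lia|]. split; [|intros; lia].
      now replace (2 * Z.of_nat (S n) + 1) with (2 * Z.of_nat n + 3) by lia.
    + destruct L as (j & jn & C & L). exists k, j. split; [lia|]. split; [assumption|].
      intros a b C' hb.
      assert (b <> 2 * Z.of_nat n + 2) by (intros ->; eauto).
      assert (b <> 2 * Z.of_nat n + 3).
      { intros ->. apply N, (top_partners D n F). eauto. }
      apply (L a b C'). lia.
Qed.

Lemma last_crossing_mono D m n k l : frieze D -> (m <= n)%nat ->
  last_crossing D m k -> last_crossing D n l -> (k <= l)%nat.
Proof.
  intros F mn (i & im & C & _) (j & jn & C' & L).
  specialize (L _ _ C ltac:(lia)).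
  pose proof (crossing_order D _ _ _ _ F C C'). lia.
Qed.

Lemma last_crossing_at D a n k : frieze D -> last_crossing D n k ->
  crossing D a (2 * Z.of_nat n + 1) -> a = 2 * Z.of_nat k + 1.
Proof.
  intros F (j & jn & C & L) C'. specialize (L _ _ C' ltac:(lia)).
  pose proof (crossing_order D _ _ _ _ F C C'). lia.
Qed.

(** The crossing at the bottom partner 2k+2 is even, so its top end 2m+2 has a
partner 2m+3, where a further odd crossing ends. *)
Lemma last_crossing_unbounded D n k : frieze D -> last_crossing D n k ->
  exists m l, last_crossing D m l /\ (k < l)%nat.
Proof.
  intros F (j & _ & C & _).
  destruct (proj1 (bottom_partners D k F) (ex_intro _ _ C)) as [b C'].
  pose proof C' as (_ & b0 & _).
  destruct (abs_parity b) as [[m hm] | [m hm]]; [lia|..].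
  - replace b with (2 * Z.of_nat m + 1) in C' by lia.
    destruct (last_crossing_exists D m F) as [l L].
    pose proof (last_crossing_at D _ m l F L C'). lia.
  - replace b with (2 * Z.of_nat m + 2) in C' by lia.
    destruct (proj1 (top_partners D m F) (ex_intro (fun a => crossing D a _) _ C'))
      as [c C''].
    destruct (last_crossing_exists D (S m) F) as [l L].
    exists (S m), l. split; [assumption|].
    replace (2 * Z.of_nat m + 3) with (2 * Z.of_nat (S m) + 1) in C'' by lia.
    pose proof (last_crossing_at D _ (S m) l F L C'').
    pose proof (crossing_order D _ _ _ _ F C' C''). lia.
Qed.

(** No crossing ends between the top intervals [n] and [n + 1], so they have the
same last crossing. *)
Lemma cup_same_regions D e h (n : nat) : frieze D ->
  (forall n, last_crossing D n (h n)) -> adjoint e h ->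
  D (2 * Z.of_nat n + 2, 2 * Z.of_nat n + 3) ->
  same_regions e h (2 * Z.of_nat n + 2, 2 * Z.of_nat n + 3).
Proof.
  intros F hL A H. split; [exact (frieze_segments D F _ H)|]. cbn [fst snd].
  replace (2 * Z.of_nat n + 3) with (2 * Z.of_nat (S n) + 1) by lia.
  rewrite regions_top_even, regions_top_odd. f_equal.
  apply Nat.le_antisymm; [apply (adjoint_mono e h A); lia|].
  apply (last_crossing_mono D n n (h (S n)) (h n) F); [lia| |apply hL].
  destruct (hL (S n)) as (j & jn & C & L). exists j.
  pose proof (crossing_not_cup D _ _ n F C H).
  split; [lia|]. split; [assumption|]. intros a b C' hb. apply (L a b C'). lia.
Qed.

(** The cap isolates the shaded bottom interval [k] from the top line, so [k] is not
a value of [h] and the two unshaded intervals beside it lie in one region. *)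
Lemma cap_same_regions D e h (k : nat) : frieze D ->
  (forall n, last_crossing D n (h n)) -> adjoint e h ->
  D (- (2 * Z.of_nat k + 2), - (2 * Z.of_nat k + 1)) ->
  same_regions e h (- (2 * Z.of_nat k + 2), - (2 * Z.of_nat k + 1)).
Proof.
  intros F hL A H. split; [exact (frieze_segments D F _ H)|]. cbn [fst snd].
  rewrite regions_bottom_even, regions_bottom_odd. f_equal.
  apply Nat.le_antisymm; [|apply (adjoint_mono_l e h A); lia].
  apply A. pose proof (A k (e k)).
  destruct (hL (e k)) as (j & _ & C & _).
  pose proof (crossing_not_cap D _ _ k F C H). lia.
Qed.

(** An odd crossing is the last one before the top interval to its right and starts
the region [k] there, so no earlier top interval reaches [k]; an even one is
followed by the odd crossing at its top partner, where [h] increases. *)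
Lemma crossing_same_regions D e h a b : frieze D ->
  (forall n, last_crossing D n (h n)) -> adjoint e h ->
  crossing D a b -> same_regions e h (- a, b).
Proof.
  intros F hL A C. pose proof C as (a0 & b0 & H).
  split; [exact (frieze_segments D F _ H)|]. cbn [fst snd].
  destruct (abs_parity b) as [[n hn] | [n hn]]; [lia|..].
  - assert (b = 2 * Z.of_nat n + 1) as -> by lia.
    assert (a = 2 * Z.of_nat (h n) + 1) as ->
      by exact (last_crossing_at D a n _ F (hL n) C).
    rewrite regions_bottom_odd, regions_top_odd. f_equal.
    apply Nat.le_antisymm; [apply A; lia|].
    pose proof (A (h n) (e (h n))).
    destruct (hL (e (h n))) as (j & jn & C' & _).
    pose proof (crossing_order D _ _ _ _ F C C'). lia.
  - assert (b = 2 * Z.of_nat n + 2) as -> by lia.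
    assert (a = 2 * Z.of_nat (h n) + 2) as ->
      by exact (crossing_even_after D n _ a F (hL n) C).
    rewrite regions_bottom_even, regions_top_even. f_equal.
    destruct (proj1 (top_partners D n F) (ex_intro (fun a => crossing D a _) _ C))
      as [c C'].
    replace (2 * Z.of_nat n + 3) with (2 * Z.of_nat (S n) + 1) in C' by lia.
    pose proof (last_crossing_at D c (S n) _ F (hL (S n)) C').
    pose proof (crossing_order D _ _ _ _ F C C').
    pose proof (A (S (h n)) n). pose proof (A (S (h n)) (S n)). lia.
Qed.

Lemma frieze_same_regions D e h s : frieze D ->
  (forall n, last_crossing D n (h n)) -> adjoint e h ->
  D s -> same_regions e h s.
Proof.
  destruct s as [a b]. intros F hL A H. pose proof (frieze_segments D F _ H) as [? [? ?]].
  cbn [fst snd] in *.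
  destruct (Z.ltb_spec 0 a).
  - destruct (frieze_cups D F _ H) as [n E]; [unfold cup; simpl; lia|].
    rewrite E in *. now apply (cup_same_regions D).
  - destruct (Z.ltb_spec b 0).
    + destruct (frieze_caps D F _ H) as [n E]; [unfold cap; simpl; lia|].
      rewrite E in *. now apply (cap_same_regions D).
    + replace a with (- - a) in * by lia. apply (crossing_same_regions D e h _ _ F hL A).
      repeat split; [lia.. | assumption].
Qed.

(** A segment of [D] ends in the first end point; its other end borders on the same
regions, so it is the second end point. *)
Lemma same_regions_frieze D e h s : frieze D ->
  (forall n, last_crossing D n (h n)) -> adjoint e h ->
  same_regions e h s -> D s.
Proof.
  destruct s as [a b]. intros F hL A [[na [nb ab]] E]. cbn [fst snd] in *.
  destruct (frieze_exhausting D F a na) as [[x y] [H xy]].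
  pose proof (frieze_same_regions D e h _ F hL A H) as [[nx [ny ?]] E'].
  unfold end_point in xy. cbn [fst snd] in *.
  destruct xy as [-> | ->].
  - destruct (no_three_same_regions e h x y b A) as [|[| ->]]; try assumption; lia.
  - destruct (no_three_same_regions e h y x b A) as [|[|]]; congruence || lia.
Qed.

Lemma frieze_described D : frieze D -> exists e h, described D e h.
Proof.
  intros F.
  pose (h := fun n => proj1_sig
    (constructive_indefinite_description _ (last_crossing_exists D n F))).
  assert (hL : forall n, last_crossing D n (h n)).
  { intros n. unfold h.
    now destruct (constructive_indefinite_description _ (last_crossing_exists D n F)). }
  clearbody h.
  destruct (adjoint_exists h) as [e A].
  - intros m n mn. exact (last_crossing_mono D m n _ _ F mn (hL m) (hL n)).
  - intros j. induction j as [|j [n IH]]; [exists 0%nat; lia|].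
    destruct (last_crossing_unbounded D n _ F (hL n)) as (m & l & L & kl).
    exists m. pose proof (last_crossing_mono D m m _ _ F (le_n _) L (hL m)). lia.
  - exists e, h. split; [assumption|]. intros s. split.
    + exact (frieze_same_regions D e h s F hL A).
    + exact (same_regions_frieze D e h s F hL A).
Qed.

Theorem mainTheorem9 (D1 D2 : Z * Z -> Prop)
    (hD1 : frieze D1) (hD2 : frieze D2) :
  phi (frieze_comp D2 D1) = compose (phi D2) (phi D1).
Proof.
  destruct (frieze_described D1 hD1) as (e1 & h1 & d1).
  destruct (frieze_described D2 hD2) as (e2 & h2 & d2).
  rewrite (phi_described D1 e1 h1 d1), (phi_described D2 e2 h2 d2).
  apply (phi_described _ (compose e1 e2)).
  exact (described_comp _ _ _ _ _ _ d1 d2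
    (frieze_exhausting D1 hD1) (frieze_exhausting D2 hD2)).
Qed.
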